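(* The series $\mathcal{V}(z,q)$ and $\mathcal{X}(z,q)$ belong to $\mathscr{U}_{z,q}^2$. In particular, $V(m,n)\ge V(m+2,n)$ and $X(m,n)\ge X(m+2,n)$ for all integers $m,n\ge 0$.
   Context: $(a;q)_n=\prod_{0\le j<n}(1-aq^j)$ for $n\in\mathbb{N}_0\cup\{\infty\}$ and $(a,b;q)_n=(a;q)_n(b;q)_n$. Define $V(m,n),X(m,n)$ by the formal expansions (power series in $q$ whose coefficients are Laurent polynomials in $z$) $$\mathcal{V}(z,q)=\sum_{n\ge0}\sum_{m\in\mathbb{Z}}V(m,n)z^mq^n=\sum_{n\ge0}\frac{q^n}{(zq^{n+1},z^{-1}q^{n+1};q)_\infty},\quad \mathcal{X}(z,q)=\sum_{n\ge0}\sum_{m\in\mathbb{Z}}X(m,n)z^mq^n=\sum_{n\ge0}\frac{q^{n+1}}{(zq,z^{-1}q;q)_n}$$ (these count concave, resp. convex, compositions of $n$ by rank $m$). For $\nu\in\{1,2\}$, $\mathscr{U}_z^\nu$ is the set of Laurent polynomials $\sum_i c_iz^i$ with real $c_i\ge0$, $c_{-i}=c_i$, and $c_{r+\ell\nu}\ge c_{r+(\ell+1)\nu}$ for all $0\le r<\nu$, $\ell\ge0$; a series $\sum_n C_n(z)q^n$ with Laurent polynomial coefficients lies in $\mathscr{U}_{z,q}^\nu$ if every $C_n(z)\in\mathscr{U}_z^\nu$. *)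

(* Defs.v *)
From HB Require Import structures.
From mathcomp Require Import all_boot all_order all_algebra.
From mathcomp Require Import finmap boolp classical_sets reals.

Set Implicit Arguments.
Unset Strict Implicit.
Unset Printing Implicit Defensive.

Import Order.TTheory GRing.Theory Num.Theory.
Local Open Scope ring_scope.

(* Laurent polynomials in z: [f i] is the coefficient of z^i. *)

Definition laurent (R : comNzRingType) := {fsfun int -> R with 0}.

HB.instance Definition _ (R : comNzRingType) := Choice.on (laurent R).

Section LaurentRing.
Variable R : comNzRingType.
Implicit Types (f g h : laurent R) (A B : {fset int}).

Definition laurent_opp f : laurent R := [fsfun i in finsupp f => - f i].

Definition laurent_add f g : laurent R :=
  [fsfun i in (finsupp f `|` finsupp g)%fset => f i + g i].

Definition laurent_mon (k : int) : laurent R := [fsfun i in [fset k]%fset => 1].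

Definition laurent_mul f g : laurent R :=
  [fsfun k in [fset (i + j)%R | i in finsupp f, j in finsupp g]%fset =>
    \sum_(i <- finsupp f) \sum_(j <- finsupp g | i + j == k) f i * g j].

Lemma laurent_oppE f k : laurent_opp f k = - f k.
Proof. by rewrite fsfunE; case: finsuppP => // _; rewrite oppr0. Qed.

Lemma laurent_addE f g k : laurent_add f g k = f k + g k.
Proof.
rewrite fsfunE in_fsetU; case: finsuppP => //= _; case: finsuppP => //= _.
by rewrite addr0.
Qed.

Lemma laurent_monE k i : laurent_mon k i = (i == k)%:R.
Proof. by rewrite fsfunE inE; case: eqP. Qed.

Lemma laurent_mulE f g k : laurent_mul f g k =
  \sum_(i <- finsupp f) \sum_(j <- finsupp g | i + j == k) f i * g j.
Proof.
rewrite fsfunE; case: ifPn => // /imfset2P hk.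
rewrite big_seq big1// => i fi; rewrite big_seq_cond big1// => j /andP[gj /eqP e].
by case: hk; exists i => //; exists j.
Qed.

Lemma laurent_mulEw A B f g k :
  (finsupp f `<=` A)%fset -> (finsupp g `<=` B)%fset ->
  laurent_mul f g k =
  \sum_(i <- A) \sum_(j <- B) (f i * g j) *+ (i + j == k).
Proof.
move=> fA gB; rewrite laurent_mulE (big_fset_incl _ fA); last first.
  by move=> i _ fi; rewrite big1// => j _; rewrite fsfun_dflt// mul0r.
apply: eq_bigr => i _; rewrite big_mkcond (big_fset_incl _ gB); last first.
  by move=> j _ gj; rewrite (fsfun_dflt gj) mulr0 if_same.
by apply: eq_bigr => j _; case: eqP.
Qed.

Lemma laurent_addA : associative laurent_add.
Proof. by move=> f g h; apply/fsfunP => i; rewrite !laurent_addE addrA. Qed.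

Lemma laurent_addC : commutative laurent_add.
Proof. by move=> f g; apply/fsfunP => i; rewrite !laurent_addE addrC. Qed.

Lemma laurent_add0 : left_id ([fsfun] : laurent R) laurent_add.
Proof. by move=> f; apply/fsfunP => i; rewrite laurent_addE fsfunE add0r. Qed.

Lemma laurent_addN : left_inverse ([fsfun] : laurent R) laurent_opp laurent_add.
Proof.
by move=> f; apply/fsfunP => i; rewrite laurent_addE laurent_oppE fsfunE addNr.
Qed.

Lemma laurent_mulC : commutative laurent_mul.
Proof.
move=> f g; apply/fsfunP => k.
rewrite !(laurent_mulEw _ (fsubset_refl _) (fsubset_refl _)) exchange_big /=.
by apply: eq_bigr => j _; apply: eq_bigr => i _; rewrite addrC mulrC.
Qed.

Lemma laurent_mul1 : left_id (laurent_mon 0) laurent_mul.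
Proof.
move=> f; apply/fsfunP => k.
have s1 : (finsupp (laurent_mon 0) `<=` [fset 0])%fset.
  apply/fsubsetP => i; rewrite mem_finsupp laurent_monE inE.
  by case: (i == 0); rewrite ?eqxx.
rewrite (laurent_mulEw _ s1 (fsubset_refl _)) big_seq_fset1 laurent_monE eqxx.
under eq_bigr do rewrite mul1r add0r.
case: (finsuppP f k) => [fk|kf].
  rewrite big_seq big1// => j jf; case: eqP => // e.
  by rewrite e in jf; rewrite jf in fk.
rewrite (big_fsetD1 k)//= eqxx big_seq big1 ?addr0// => j.
by rewrite !inE => /andP[/negPf-> _].
Qed.

Lemma laurent_mulDl : left_distributive laurent_mul laurent_add.
Proof.
move=> f g h; apply/fsfunP => k; rewrite laurent_addE.
have sD : (finsupp (laurent_add f g) `<=` (finsupp f `|` finsupp g))%fset.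
  apply/fsubsetP => i; apply: contraTT => ifg.
  rewrite memNfinsupp laurent_addE; apply/eqP.
  move: ifg; rewrite in_fsetU negb_or => /andP[fi gi].
  by rewrite (fsfun_dflt fi) (fsfun_dflt gi) addr0.
rewrite (laurent_mulEw _ sD (fsubset_refl _)).
rewrite (laurent_mulEw _ (fsubsetUl _ (finsupp g)) (fsubset_refl _)).
rewrite (laurent_mulEw _ (fsubsetUr (finsupp f) _) (fsubset_refl _)).
rewrite -big_split; apply: eq_bigr => i _ /=; rewrite -big_split.
by apply: eq_bigr => j _ /=; rewrite laurent_addE mulrDl mulrnDl.
Qed.

(* Associativity goes through a triple sum symmetric in the bracketing. *)
Lemma laurent_mul3E f g h m : laurent_mul (laurent_mul f g) h m =
  \sum_(i <- finsupp f) \sum_(j <- finsupp g) \sum_(l <- finsupp h)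
    (f i * g j * h l) *+ (i + j + l == m).
Proof.
set A := [fset (i + j)%R | i in finsupp f, j in finsupp g]%fset.
have sA : (finsupp (laurent_mul f g) `<=` A)%fset.
  apply/fsubsetP => k; apply: contraTT => kA.
  by rewrite memNfinsupp fsfunE (negPf kA).
rewrite (laurent_mulEw _ sA (fsubset_refl _)).
transitivity (\sum_(k <- A) \sum_(l <- finsupp h)
    \sum_(i <- finsupp f) \sum_(j <- finsupp g)
    (f i * g j * h l) *+ (k + l == m) *+ (i + j == k)).
  apply: eq_bigr => k _; apply: eq_bigr => l _.
  rewrite (laurent_mulEw _ (fsubset_refl _) (fsubset_refl _)).
  rewrite mulr_suml -sumrMnl; apply: eq_bigr => i _.
  rewrite mulr_suml -sumrMnl; apply: eq_bigr => j _.
  by rewrite mulrnAl mulrnAC.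
under eq_bigr => k _ do rewrite exchange_big /=.
rewrite exchange_big /= big_seq [RHS]big_seq; apply: eq_bigr => i fi.
under eq_bigr => k _ do rewrite exchange_big /=.
rewrite exchange_big /= big_seq [RHS]big_seq; apply: eq_bigr => j gj.
rewrite exchange_big /=; apply: eq_bigr => l _.
have ijA : i + j \in A by apply/imfset2P; exists i => //; exists j.
rewrite (big_fsetD1 (i + j))//= eqxx big_seq big1 ?addr0// => k.
by rewrite !inE eq_sym => /andP[/negPf-> _].
Qed.

Lemma laurent_mulA : associative laurent_mul.
Proof.
move=> f g h; rewrite [laurent_mul f _]laurent_mulC; apply/fsfunP => m.
rewrite !laurent_mul3E [RHS]exchange_big /=; apply: eq_bigr => j _.
rewrite [RHS]exchange_big /= ; apply: eq_bigr => l _.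
apply: eq_bigr => i _.
by rewrite -(mulrA (f i)) (mulrC (f i)) -(addrA i) (addrC i).
Qed.

Lemma laurent_1neq0 : laurent_mon 0 != [fsfun].
Proof.
apply/eqP => /fsfunP /(_ 0); rewrite laurent_monE fsfunE eqxx.
by apply/eqP/oner_neq0.
Qed.

HB.instance Definition _ := GRing.isZmodule.Build (laurent R)
  laurent_addA laurent_addC laurent_add0 laurent_addN.

HB.instance Definition _ := GRing.Zmodule_isComNzRing.Build (laurent R)
  laurent_mulA laurent_mulC laurent_mul1 laurent_mulDl laurent_1neq0.

End LaurentRing.

(* Formal power series in q over A: [f n] is the coefficient of q^n. *)

Record fps (A : Type) := Fps { fps_coef : nat -> A }.
Coercion fps_coef : fps >-> Funclass.

HB.instance Definition _ (A : Type) := gen_eqMixin (fps A).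
HB.instance Definition _ (A : Type) := gen_choiceMixin (fps A).

Lemma fpsP (A : Type) (f g : fps A) : f =1 g <-> f = g.
Proof.
split=> [|-> //]; case: f g => f [g] /= fg.
by congr Fps; apply: funext.
Qed.

Section FpsRing.
Variable A : comNzRingType.
Implicit Types f g h : fps A.

Definition fpsC (c : A) : fps A := Fps (fun n => if n == 0%N then c else 0).
Definition fpsX : fps A := Fps (fun n => (n == 1%N)%:R).
Definition fps_opp f : fps A := Fps (fun n => - f n).
Definition fps_add f g : fps A := Fps (fun n => f n + g n).
Definition fps_mul f g : fps A :=
  Fps (fun n => \sum_(i < n.+1) f i * g (n - i)%N).

Definition fps_trunc N f : {poly A} := \poly_(i < N) f i.

Lemma fps_mul_trunc N f g k : (k < N)%N ->
  fps_mul f g k = (fps_trunc N f * fps_trunc N g)`_k.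
Proof.
move=> kN; rewrite coefM; apply: eq_bigr => i _ /=.
rewrite !coef_poly (leq_ltn_trans _ kN) 1?(leq_ltn_trans _ kN) ?leq_subr//.
by rewrite -ltnS.
Qed.

Lemma fps_addA : associative fps_add.
Proof. by move=> f g h; apply/fpsP => n /=; rewrite addrA. Qed.

Lemma fps_addC : commutative fps_add.
Proof. by move=> f g; apply/fpsP => n /=; rewrite addrC. Qed.

Lemma fps_add0 : left_id (fpsC 0) fps_add.
Proof. by move=> f; apply/fpsP => n /=; rewrite if_same add0r. Qed.

Lemma fps_addN : left_inverse (fpsC 0) fps_opp fps_add.
Proof. by move=> f; apply/fpsP => n /=; rewrite if_same addNr. Qed.

Lemma fps_mulC : commutative fps_mul.
Proof.
by move=> f g; apply/fpsP => n; rewrite !(@fps_mul_trunc n.+1)// mulrC.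
Qed.

Lemma fps_mulA : associative fps_mul.
Proof.
move=> f g h; apply/fpsP => n.
transitivity ((fps_trunc n.+1 f * (fps_trunc n.+1 g * fps_trunc n.+1 h))`_n).
  rewrite coefM; apply: eq_bigr => i _.
  by rewrite coef_poly ltn_ord -fps_mul_trunc// ltnS leq_subr.
rewrite mulrA coefM; apply: eq_bigr => i _.
by rewrite coef_poly ltnS leq_subr -fps_mul_trunc.
Qed.

Lemma fps_mul1 : left_id (fpsC 1) fps_mul.
Proof.
move=> f; apply/fpsP => n /=; rewrite big_ord_recl /= mul1r subn0.
by rewrite big1 ?addr0// => i _; rewrite mul0r.
Qed.

Lemma fps_mulDl : left_distributive fps_mul fps_add.
Proof.
move=> f g h; apply/fpsP => n /=; rewrite -big_split.
by apply: eq_bigr => i _; rewrite mulrDl.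
Qed.

Lemma fps_1neq0 : fpsC 1 != fpsC 0.
Proof.
by apply/eqP => /fpsP /(_ 0%N) /= /eqP; rewrite (negPf (oner_neq0 _)).
Qed.

HB.instance Definition _ := GRing.isZmodule.Build (fps A)
  fps_addA fps_addC fps_add0 fps_addN.

HB.instance Definition _ := GRing.Zmodule_isComNzRing.Build (fps A)
  fps_mulA fps_mulC fps_mul1 fps_mulDl fps_1neq0.

(* As the ring is commutative, the chosen inverse is the only one. *)
Definition fps_unit : {pred fps A} := fun f => `[< exists g, g * f = 1 >].
Definition fps_inv f : fps A := xget f [set g | g * f = 1].

Lemma fps_mulVx : {in fps_unit, left_inverse 1 fps_inv *%R}.
Proof. by move=> f /asboolP fu; exact: (xgetPex f fu). Qed.

Lemma fps_unitPl f g : g * f = 1 -> fps_unit f.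
Proof. by move=> gf; apply/asboolP; exists g. Qed.

Lemma fps_inv_out : {in [predC fps_unit], fps_inv =1 id}.
Proof.
by move=> f /asboolPn fu; apply: xgetPN => g gf; apply: fu; exists g.
Qed.

HB.instance Definition _ := GRing.ComNzRing_hasMulInverse.Build (fps A)
  fps_mulVx fps_unitPl fps_inv_out.

Lemma fps_coef0 n : (0 : fps A) n = 0. Proof. exact: if_same. Qed.
Lemma fps_coef1 n : (1 : fps A) n = (n == 0%N)%:R. Proof. by case: n. Qed.
Lemma fps_coefD f g n : (f + g) n = f n + g n. Proof. by []. Qed.
Lemma fps_coefN f n : (- f) n = - f n. Proof. by []. Qed.
Lemma fps_coefM f g n : (f * g) n = \sum_(i < n.+1) f i * g (n - i)%N.
Proof. by []. Qed.

Lemma fps_coefM0 f g : (f * g) 0%N = f 0%N * g 0%N.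
Proof. by rewrite fps_coefM big_ord1. Qed.

Definition fps_val_ge (k : nat) f : Prop := forall n, (n < k)%N -> f n = 0.

Lemma fps_val_geM k l f g :
  fps_val_ge k f -> fps_val_ge l g -> fps_val_ge (k + l) (f * g).
Proof.
move=> vf vg n nkl; rewrite fps_coefM big1// => i _.
have [ik|ki] := ltnP i k; first by rewrite vf// mul0r.
have ile : (i <= n)%N by rewrite -ltnS.
by rewrite vg ?mulr0// ltn_subLR// (leq_trans nkl)// leq_add2r.
Qed.

Lemma fps_val_geX f n : f 0%N = 0 -> fps_val_ge n (f ^+ n).
Proof.
move=> f0; elim: n => [//|n IHn]; rewrite exprS -add1n.
by apply: fps_val_geM => // -[].
Qed.

Lemma fps_val_geXnM n f : fps_val_ge n (fpsX ^+ n * f).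
Proof.
rewrite -[X in fps_val_ge X]addn0; apply: fps_val_geM => //.
exact: fps_val_geX.
Qed.

(* q-adic convergence: each coefficient is eventually constant. *)
Definition fps_cvg (u : nat -> fps A) (l : fps A) : Prop :=
  forall N : nat, exists k : nat, forall n : nat, (k <= n)%N -> u n N = l N.

(* The q-adic limit (0 if there is none). *)
Definition fps_lim (u : nat -> fps A) : fps A := xget 0 [set l | fps_cvg u l].

Lemma fps_limE u l : fps_cvg u l -> fps_lim u = l.
Proof.
move=> ul; apply: xget_unique => // l' ul'; apply/fpsP => N.
have [[k hk] [k' hk']] := (ul N, ul' N).
by rewrite -(hk (maxn k k')) ?leq_maxl// hk' ?leq_maxr.
Qed.

Lemma fps_cvg_step u :
  (forall n, fps_val_ge n (u n.+1 - u n)) ->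
  fps_cvg u (Fps (fun N => u N.+1 N)).
Proof.
move=> h N; exists N.+1 => n; elim: n => // n IHn; rewrite leq_eqVlt.
move=> /predU1P[<-//|Nn]; rewrite -(IHn Nn).
by apply/eqP; rewrite -subr_eq0; apply/eqP; exact: (h n N Nn).
Qed.

Definition qpoch (a : fps A) (n : nat) : fps A :=
  \prod_(j < n) (1 - a * fpsX ^+ j).
Definition qpoch_inf (a : fps A) : fps A := fps_lim (qpoch a).

Definition fps_sum (F : nat -> fps A) : fps A :=
  fps_lim (fun N => \sum_(n < N) F n).

Lemma qpoch_cvg (a : fps A) : fps_cvg (qpoch a) (qpoch_inf a).
Proof.
have h : forall n, fps_val_ge n (qpoch a n.+1 - qpoch a n).
  move=> n; rewrite /qpoch big_ord_recr /= mulrBr mulr1 addrAC subrr add0r.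
  rewrite mulrA -mulNr mulrC; exact: fps_val_geXnM.
by rewrite /qpoch_inf (fps_limE (fps_cvg_step h)); exact: fps_cvg_step.
Qed.

Lemma fps_sum_cvg F : (forall n, fps_val_ge n (F n)) ->
  fps_cvg (fun N => \sum_(n < N) F n) (fps_sum F).
Proof.
move=> vF; have h n : fps_val_ge n (\sum_(i < n.+1) F i - \sum_(i < n) F i).
  by rewrite big_ord_recr /= addrAC subrr add0r.
rewrite /fps_sum (fps_limE (fps_cvg_step h)); exact: (fps_cvg_step h).
Qed.

Lemma fps_unit1 f : f 0%N = 1 -> f \is a GRing.unit.
Proof.
move=> f1; set h := 1 - f; pose S n := \sum_(i < n) h ^+ i.
have h0 : h 0%N = 0 by rewrite fps_coefD fps_coefN fps_coef1 f1 subrr.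
have hS n : fps_val_ge n (S n.+1 - S n).
  by rewrite /S big_ord_recr /= addrAC subrr add0r; exact: fps_val_geX.
have fS n : f * S n = 1 - h ^+ n.
  have -> : f = - (h - 1) by rewrite /h addrAC subrr add0r opprK.
  by rewrite mulNr -subrX1 opprB.
have [g Sg] : exists g, fps_cvg S g.
  by eexists; exact: fps_cvg_step.
apply: (@fps_unitPl f g); rewrite mulrC; apply/fpsP => N.
have [K hK] : exists K, forall n i, (K <= n)%N -> (i <= N)%N -> S n i = g i.
  elim: N => [|N [K hK]].
    have [K hK] := Sg 0%N; exists K => n i Kn; rewrite leqn0 => /eqP->.
    exact: hK.
  have [K' hK'] := Sg N.+1; exists (maxn K K') => n i.
  rewrite geq_max => /andP[Kn K'n]; rewrite leq_eqVlt => /predU1P[->|].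
    exact: hK'.
  by rewrite ltnS; exact: hK.
pose n := maxn K N.+1; transitivity ((f * S n) N).
  by rewrite !fps_coefM; apply: eq_bigr => i _; rewrite hK ?leq_subr// leq_maxl.
by rewrite fS fps_coefD fps_coefN (fps_val_geX h0) ?subr0// leq_maxr.
Qed.

Lemma qpoch0 (a : fps A) n : a 0%N = 0 -> qpoch a n 0%N = 1.
Proof.
move=> a0; rewrite /qpoch; elim: n => [|n IHn]; first by rewrite big_ord0.
rewrite big_ord_recr fps_coefM0 IHn mul1r fps_coefD fps_coefN fps_coefM0.
by rewrite fps_coef1 a0 mul0r subr0.
Qed.

Lemma qpoch_unit (a : fps A) n : a 0%N = 0 -> qpoch a n \is a GRing.unit.
Proof. by move=> a0; apply: fps_unit1; exact: qpoch0. Qed.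

Lemma qpoch_inf_unit (a : fps A) : a 0%N = 0 -> qpoch_inf a \is a GRing.unit.
Proof.
move=> a0; apply: fps_unit1; have [k /(_ k (leqnn k)) <-] := qpoch_cvg a 0%N.
exact: qpoch0.
Qed.

End FpsRing.

Arguments fpsX {A}.

Section Series.
Variable R : comNzRingType.

Local Notation z := (fpsC (laurent_mon R 1)).
Local Notation zV := (fpsC (laurent_mon R (-1))).
Local Notation q := (@fpsX (laurent R)).

Definition serV_term (n : nat) : fps (laurent R) :=
  q ^+ n / (qpoch_inf (z * q ^+ n.+1) * qpoch_inf (zV * q ^+ n.+1)).
Definition serX_term (n : nat) : fps (laurent R) :=
  q ^+ n.+1 / (qpoch (z * q) n * qpoch (zV * q) n).

Definition serV : fps (laurent R) := fps_sum serV_term.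
Definition serX : fps (laurent R) := fps_sum serX_term.

Definition Vcoef (m : int) (n : nat) : R := serV n m.
Definition Xcoef (m : int) (n : nat) : R := serX n m.

(* The fractions and infinite sums above take no junk values. *)
Lemma serV_term_denom_unit n :
  qpoch_inf (z * q ^+ n.+1) * qpoch_inf (zV * q ^+ n.+1) \is a GRing.unit.
Proof. by rewrite unitrM !qpoch_inf_unit// mulrC; exact: fps_val_geXnM. Qed.

Lemma serX_term_denom_unit n :
  qpoch (z * q) n * qpoch (zV * q) n \is a GRing.unit.
Proof.
by rewrite unitrM !qpoch_unit// fps_coefM0 mulr0.
Qed.

Lemma serV_cvg : fps_cvg (fun N => \sum_(n < N) serV_term n) serV.
Proof. by apply: fps_sum_cvg => n; exact: fps_val_geXnM. Qed.

Lemma serX_cvg : fps_cvg (fun N => \sum_(n < N) serX_term n) serX.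
Proof.
apply: fps_sum_cvg => n k kn; apply: (@fps_val_geXnM _ n.+1).
exact: ltn_trans (ltnSn n).
Qed.

End Series.

Section Unimodal.
Variables (R : realType) (nu : nat).

Definition laurent_unimodal (c : laurent R) : Prop :=
  [/\ forall i : int, 0 <= c i,
      forall i : int, c (- i) = c i &
      forall r l : nat, (r < nu)%N ->
        c (r + l.+1 * nu)%N%:Z <= c (r + l * nu)%N%:Z].

Definition series_unimodal (C : fps (laurent R)) : Prop :=
  forall n : nat, laurent_unimodal (C n).

End Unimodal.

(* Main.v *)
Require Import Defs.
From mathcomp Require Import all_boot all_order all_algebra reals.
From mathcomp Require Import finmap zify ring.
Local Open Scope ring_scope.
Import Order.TTheory GRing.Theory Num.Theory.

(** With [nu = 2], the unimodal Laurent polynomials are the nonnegative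
    combinations of the SU(2) characters
    [chi_n = z^n + z^(n-2) + ... + z^(-n)].  Each factor
    [1 / ((1 - z q^d) (1 - z^-1 q^d))] expands as [sum_n chi_n q^(d n)], so it is
    enough that multiplication by [chi_n] preserves unimodality.  This follows
    from [(z - z^-1) chi_n = z^(n+1) - z^-(n+1)]: the coefficient at [k > 0] of
    [(z - z^-1) chi_n f] is [f (k - n - 1) - f (k + n + 1)], which is nonnegative
    because [|k - n - 1| <= k + n + 1] and both indices have the same parity. *)

(** * Laurent polynomials and the characters [chi n] *)

Section Laurent.
Variable R : comNzRingType.
Implicit Types f g : laurent R.

Lemma laurentD f g i : (f + g) i = f i + g i.
Proof. exact: laurent_addE. Qed.

Lemma laurentN f i : (- f) i = - f i.
Proof. exact: laurent_oppE. Qed.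

Lemma laurent0 i : (0 : laurent R) i = 0.
Proof. by rewrite -(subrr (1 : laurent R)) laurentD laurentN subrr. Qed.

Lemma laurent1 i : (1 : laurent R) i = (i == 0)%:R.
Proof. exact: laurent_monE. Qed.

Lemma laurent_mon_mul (k : int) f i : (laurent_mon R k * f) i = f (i - k).
Proof.
have s1 : (finsupp (laurent_mon R k) `<=` [fset k])%fset.
  apply/fsubsetP => j; rewrite mem_finsupp laurent_monE inE.
  by case: (j == k); rewrite ?eqxx.
(* Enlarging the support by [i - k] lets that term be split off even when [f] vanishes there. *)
have s2 : (finsupp f `<=` (i - k) |` finsupp f)%fset by exact: fsubsetUr.
have ki : k + (i - k) = i by rewrite addrC subrK.
rewrite [LHS](laurent_mulEw i s1 s2) big_seq_fset1 laurent_monE eqxx.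
rewrite (big_fsetD1 (i - k)) ?fset1U1//= ki eqxx mul1r mulr1n.
rewrite big_seq big1 ?addr0// => j.
rewrite !inE => /andP[jik _]; case: eqP => // e.
by rewrite -e [k + j]addrC addrK eqxx in jik.
Qed.

Lemma laurent_mon_mulN (k : int) : laurent_mon R k * laurent_mon R (- k) = 1.
Proof.
apply/fsfunP => i.
rewrite laurent_mon_mul laurent_monE laurent1 -[X in _ == X]add0r.
by rewrite (inj_eq (addIr _)).
Qed.

Lemma laurent_bounded f :
  exists N : nat, forall n : nat, (N <= n)%N -> f n%:Z = 0.
Proof.
(* This sum dominates each of its terms, so it exceeds [|i|] for every [i] in the support. *)
exists (\sum_(i <- finsupp f) `|i|%N.+1)%N => n; apply: contraTeq => fn.
rewrite -ltnNge (big_fsetD1 n%:Z) ?mem_finsupp//=; lia.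
Qed.

Definition zD : laurent R := laurent_mon R 1 + laurent_mon R (-1).

Lemma zD_mul f i : (zD * f) i = f (i - 1) + f (i + 1).
Proof. by rewrite mulrDl laurentD !laurent_mon_mul opprK. Qed.

Lemma zD_mul_sym f : (forall i, f (- i) = f i) ->
  forall i, (zD * f) (- i) = (zD * f) i.
Proof.
move=> fs i; rewrite !zD_mul -(fs (i - 1)) -(fs (i + 1)) !opprD opprK.
exact: addrC.
Qed.

(** Carries two consecutive characters, so that the Chebyshev recurrence in [z + z^-1] becomes
    structural. *)
Fixpoint chi_pair (n : nat) : laurent R * laurent R :=
  if n is n'.+1 then let: (a, b) := chi_pair n' in (b, zD * b - a) else (1, zD).

Definition chi n := (chi_pair n).1.

Lemma chi0 : chi 0 = 1. Proof. by []. Qed.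
Lemma chi1 : chi 1 = zD. Proof. by []. Qed.

Lemma chiSS n : chi n.+2 = zD * chi n.+1 - chi n.
Proof. by rewrite /chi /=; case: (chi_pair n). Qed.

Lemma chi_ind (P : laurent R -> Prop) : P 1 -> P zD ->
  (forall f g, P f -> P g -> P (zD * g - f)) -> forall n, P (chi n).
Proof.
move=> P0 P1 PS n; suff: P (chi n) /\ P (chi n.+1) by case.
by elim: n => [//|n [IH0 IH1]]; split=> //; rewrite chiSS; exact: PS.
Qed.

Lemma chi_mul_sym f n : (forall i, f (- i) = f i) ->
  forall i, (chi n * f) (- i) = (chi n * f) i.
Proof.
move=> fs; apply: (chi_ind (fun c => forall i, (c * f) (- i) = (c * f) i)).
- by move=> i; rewrite mul1r fs.
- exact: zD_mul_sym.
move=> c d cs ds i; rewrite !mulrBl !laurentD !laurentN cs -!mulrA.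
by rewrite (zD_mul_sym _ ds).
Qed.

(** Coefficient at [k] of [(z - z^-1) chi_n f = (z^(n+1) - z^-(n+1)) f]; both sides obey the
    recurrence [chiSS] in [n]. *)
Lemma chi_mul_diff f n k : (chi n * f) (k - 1) - (chi n * f) (k + 1) =
  f (k - n.+1%:Z) - f (k + n.+1%:Z).
Proof.
suff: (forall k, (chi n * f) (k - 1) - (chi n * f) (k + 1) =
      f (k - n.+1%:Z) - f (k + n.+1%:Z)) /\
    (forall k, (chi n.+1 * f) (k - 1) - (chi n.+1 * f) (k + 1) =
      f (k - n.+2%:Z) - f (k + n.+2%:Z)) by case.
elim: n {k} => [|n [IH0 IH1]].
  split=> k; first by rewrite chi0 mul1r.
  rewrite chi1 !zD_mul subrK addrK.
  have -> : k - 1 - 1 = k - 2%:Z by ring.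
  have -> : k + 1 + 1 = k + 2%:Z by ring.
  by rewrite opprD addrA addrK.
split=> // k; rewrite chiSS !mulrBl !laurentD !laurentN -!mulrA !zD_mul.
have := IH1 (k - 1); have := IH1 (k + 1); have := IH0 k.
set g0 := chi n * f; set g1 := chi n.+1 * f.
have -> : k + 1 - n.+2%:Z = k - n.+1%:Z by lia.
have -> : k + 1 + n.+2%:Z = k + n.+3%:Z by lia.
have -> : k - 1 - n.+2%:Z = k - n.+3%:Z by lia.
have -> : k - 1 + n.+2%:Z = k + n.+1%:Z by lia.
rewrite !subrK !addrK => e0 e1 e2.
(* Inserting [g1 k] groups the terms into the induction hypotheses at [k - 1], [k + 1] and [k]. *)
transitivity ((g1 (k - 1 - 1) - g1 k) + (g1 k - g1 (k + 1 + 1)) -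
  (g0 (k - 1) - g0 (k + 1))); first by ring.
by rewrite e0 e1 e2; ring.
Qed.

End Laurent.
Arguments zD {R}.
Arguments chi {R}.

(** * Unimodality in steps of two *)

Section UnimodalTwo.
Variable R : realType.
Implicit Types f g : laurent R.

(** Nonnegativity is recovered from finite support: a sequence weakly decreasing in steps of 2 that
    ends at 0 is nonnegative. *)
Lemma laurent_unimodal2P f : laurent_unimodal 2 f <->
  (forall i, f (- i) = f i) /\ (forall m : nat, f (m + 2)%N%:Z <= f m%:Z).
Proof.
split=> [[_ fs fd]|[fs fd]].
  split=> // m; have := fd (m %% 2)%N (m %/ 2)%N (@ltn_pmod m 2 isT).
  by rewrite mulSn addnCA addnC (addnC (m %% 2)%N) -divn_eq.
split=> [i|//|r l _]; last by rewrite mulSn addnCA addnC.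
suff pos (m : nat) : 0 <= f m%:Z by case: i => m //; rewrite NegzE fs.
have [N fN] := laurent_bounded _ f.
apply: (@le_trans _ _ (f (m + N * 2)%N%:Z)); first by rewrite fN//; lia.
elim: N {fN} => [|N IHN]; first by rewrite mul0n addn0.
by apply: le_trans IHN; rewrite mulSn addnCA addnC.
Qed.

Lemma laurent_unimodal2_le f (a b : nat) :
  laurent_unimodal 2 f -> f (a + b * 2)%N%:Z <= f a%:Z.
Proof.
move=> /laurent_unimodal2P[_ fd]; elim: b => [|b IHb]; first by rewrite addn0.
by apply: le_trans IHb; rewrite mulSn addnCA addnC.
Qed.

Lemma laurent_unimodal2_0 : laurent_unimodal 2 (0 : laurent R).
Proof. by apply/laurent_unimodal2P; split=> *; rewrite !laurent0. Qed.

Lemma laurent_unimodal2_1 : laurent_unimodal 2 (1 : laurent R).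
Proof.
apply/laurent_unimodal2P; split=> [i|m]; rewrite !laurent1 ?oppr_eq0//.
by rewrite addn2 ler0n.
Qed.

Lemma laurent_unimodal2D f g : laurent_unimodal 2 f -> laurent_unimodal 2 g ->
  laurent_unimodal 2 (f + g).
Proof.
move=> /laurent_unimodal2P[fs fd] /laurent_unimodal2P[gs gd].
apply/laurent_unimodal2P; split=> [i|m]; rewrite !laurentD ?fs ?gs//.
exact: lerD.
Qed.

Lemma laurent_unimodal2_chi_mul n f : laurent_unimodal 2 f ->
  laurent_unimodal 2 (chi n * f).
Proof.
move=> fu; have /laurent_unimodal2P[fs fd] := fu.
apply/laurent_unimodal2P; split=> [|m]; first exact: chi_mul_sym.
(* Centring at [k = m + 1] puts the two compared coefficients at [m] and [m + 2]. *)
have := chi_mul_diff _ f n m.+1%:Z.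
have -> : m.+1%:Z - 1 = m%:Z by lia.
have -> : m.+1%:Z + 1 = (m + 2)%N%:Z by lia.
rewrite -subr_ge0 => ->; rewrite subr_ge0.
(* The index [m - n] may be negative; symmetry of [f] then reflects it to [n - m]. *)
have [nm|mn] := leqP n m.
  have -> : m.+1%:Z - n.+1%:Z = (m - n)%N%:Z by lia.
  have -> : m.+1%:Z + n.+1%:Z = (m - n + n.+1 * 2)%N%:Z by lia.
  exact: laurent_unimodal2_le.
have -> : m.+1%:Z - n.+1%:Z = - (n - m)%N%:Z by lia.
have -> : m.+1%:Z + n.+1%:Z = (n - m + m.+1 * 2)%N%:Z by lia.
by rewrite fs; exact: laurent_unimodal2_le.
Qed.

End UnimodalTwo.

(** * Power series and q-adic limits of products and quotients *)

Section FpsFacts.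
Variable A : comNzRingType.
Implicit Types f g : fps A.

Lemma fpsC_mulE (c : A) f n : (fpsC c * f) n = c * f n.
Proof.
rewrite fps_coefM big_ord_recl /= subn0 big1 ?addr0// => i _.
by rewrite mul0r.
Qed.

Lemma fpsCM (c d : A) : fpsC (c * d) = fpsC c * fpsC d.
Proof. by apply/fpsP => n; rewrite fpsC_mulE /=; case: eqP; rewrite ?mulr0. Qed.

Lemma fpsCD (c d : A) : fpsC (c + d) = fpsC c + fpsC d.
Proof. by apply/fpsP => n; rewrite fps_coefD /=; case: eqP; rewrite ?addr0. Qed.

Lemma fpsCN (c : A) : fpsC (- c) = - fpsC c.
Proof. by apply/fpsP => n; rewrite fps_coefN /=; case: eqP; rewrite ?oppr0. Qed.

Lemma fpsX_mulE f n : (fpsX * f) n = if n is n'.+1 then f n' else 0.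
Proof.
rewrite fps_coefM big_ord_recl /= mul0r add0r; case: n => [|n].
  by rewrite big_ord0.
rewrite big_ord_recl /= mul1r subn1 /= big1 ?addr0// => i _.
by rewrite mul0r.
Qed.

Lemma fps_val_geD k f g :
  fps_val_ge k f -> fps_val_ge k g -> fps_val_ge k (f + g).
Proof. by move=> fk gk n nk; rewrite fps_coefD fk// gk// addr0. Qed.

Lemma fps_val_geMl k f g : fps_val_ge k f -> fps_val_ge k (f * g).
Proof. by move=> fk; rewrite -[k]addn0; apply: fps_val_geM. Qed.

(** Makes convergence uniform over the first [N] coefficients, as products need: a coefficient of a
    product involves all lower ones. *)
Lemma fps_cvg_val_ge u (l : fps A) : fps_cvg u l ->
  forall N, exists k, forall n, (k <= n)%N -> fps_val_ge N (u n - l).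
Proof.
move=> ul; elim=> [|N [k hk]]; first by exists 0%N.
have [k' hk'] := ul N; exists (maxn k k') => n.
rewrite geq_max => /andP[kn k'n] m; rewrite ltnS leq_eqVlt => /predU1P[->|].
  by rewrite fps_coefD fps_coefN hk' ?subrr.
exact: hk.
Qed.

Lemma fps_cvgM u v (l m : fps A) : fps_cvg u l -> fps_cvg v m ->
  fps_cvg (fun n => u n * v n) (l * m).
Proof.
move=> ul vm N.
have [k hk] := fps_cvg_val_ge _ _ ul N.+1.
have [k' hk'] := fps_cvg_val_ge _ _ vm N.+1.
exists (maxn k k') => n; rewrite geq_max => /andP[kn k'n].
apply/eqP; rewrite -subr_eq0 -fps_coefN -fps_coefD.
have -> : u n * v n - l * m = (u n - l) * v n + (v n - m) * l by ring.
apply/eqP; apply: (@fps_val_geD N.+1) => //; apply: fps_val_geMl.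
  exact: hk.
exact: hk'.
Qed.

Lemma fps_cvg_div f u (l : fps A) : (forall n, u n \is a GRing.unit) ->
  l \is a GRing.unit -> fps_cvg u l -> fps_cvg (fun n => f / u n) (f / l).
Proof.
move=> uu lu ul N; have [k hk] := fps_cvg_val_ge _ _ ul N.+1.
exists k => n kn; apply/eqP; rewrite -subr_eq0 -fps_coefN -fps_coefD; apply/eqP.
have -> : f / u n - f / l = (u n - l) * (- f * (u n)^-1 * l^-1).
  transitivity (f * (u n)^-1 * (l * l^-1) - f * l^-1 * (u n * (u n)^-1)).
    by rewrite !mulrV// !mulr1.
  by ring.
by apply: (fps_val_geMl N.+1) => //; exact: hk.
Qed.

End FpsFacts.

(** * Division by q-Pochhammer factors *)

Section SeriesUnimodal.
Variable R : realType.
Implicit Types f g : fps (laurent R).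
Local Notation z := (fpsC (laurent_mon R 1)).
Local Notation zV := (fpsC (laurent_mon R (-1))).
Local Notation q := (@fpsX (laurent R)).

Lemma series_unimodal2_1 : series_unimodal 2 (1 : fps (laurent R)).
Proof.
case=> [|n]; rewrite fps_coef1; first exact: laurent_unimodal2_1.
exact: laurent_unimodal2_0.
Qed.

Lemma series_unimodal2_sum (F : nat -> fps (laurent R)) N :
  (forall n, series_unimodal 2 (F n)) ->
  series_unimodal 2 (\sum_(n < N) F n).
Proof.
move=> Fu; elim: N => [|N IHN] n.
  by rewrite big_ord0 fps_coef0; exact: laurent_unimodal2_0.
by rewrite big_ord_recr /=; apply: laurent_unimodal2D; [exact: IHN|exact: Fu].
Qed.

Lemma series_unimodal2_Xn_mul d f :
  series_unimodal 2 f -> series_unimodal 2 (q ^+ d * f).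
Proof.
move=> fu; elim: d => [|d IHd]; first by rewrite mul1r.
rewrite exprS -mulrA => -[|n]; rewrite fpsX_mulE; last exact: IHd.
exact: laurent_unimodal2_0.
Qed.

(** Each coefficient of the limit already occurs as a coefficient of some [u k]. *)
Lemma series_unimodal2_cvg u (l : fps (laurent R)) : fps_cvg u l ->
  (forall n, series_unimodal 2 (u n)) -> series_unimodal 2 l.
Proof. by move=> ul uu N; have [k /(_ k (leqnn k)) <-] := ul N; exact: uu. Qed.

(** Truncated generating function of the characters with its exact remainder; [chiSS] makes the sum
    telescope. *)
Lemma chi_generating d K :
  (1 - z * q ^+ d) * (1 - zV * q ^+ d) *
    (\sum_(n < K.+1) q ^+ (d * n) * fpsC (chi n)) =
  1 + q ^+ (d * K.+1) * (q ^+ d * fpsC (chi K) - fpsC (chi K.+1)).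
Proof.
have zz : z * zV = 1 by rewrite -fpsCM laurent_mon_mulN.
have zzV : fpsC zD = z + zV by rewrite fpsCD.
have -> : (1 - z * q ^+ d) * (1 - zV * q ^+ d) =
    1 - fpsC zD * q ^+ d + q ^+ d * q ^+ d.
  transitivity (1 - (z + zV) * q ^+ d + z * zV * (q ^+ d * q ^+ d)).
    by ring.
  by rewrite zz mul1r zzV.
elim: K => [|K IHK].
  rewrite big_ord1 chi0 chi1 muln0 muln1.
  by rewrite [fpsC 1](_ : _ = 1)//; ring.
have -> : fpsC (@chi R K.+2) = fpsC zD * fpsC (chi K.+1) - fpsC (chi K).
  by rewrite -fpsCM -fpsCN -fpsCD -chiSS.
rewrite big_ord_recr /= mulrDr IHK.
by rewrite (mulnS d K.+1) exprD; ring.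
Qed.

Lemma series_unimodal2_div d f : (0 < d)%N -> series_unimodal 2 f ->
  series_unimodal 2 (f / ((1 - z * q ^+ d) * (1 - zV * q ^+ d))).
Proof.
move=> d0 fu; set P := (1 - _) * (1 - _).
have Pu : P \is a GRing.unit.
  apply: fps_unit1; rewrite fps_coefM0 !fps_coefD !fps_coefN !fps_coefM0.
  by rewrite (@fps_val_geX _ q d) // !mulr0 subr0 mulr1.
pose u K := \sum_(n < K.+1) q ^+ (d * n) * (fpsC (chi n) * f).
apply: (@series_unimodal2_cvg u) => [N|K]; last first.
  apply: (series_unimodal2_sum
    (fun n => q ^+ (d * n) * (fpsC (chi n) * f))) => n.
  apply: series_unimodal2_Xn_mul => m; rewrite fpsC_mulE.
  exact: laurent_unimodal2_chi_mul.
(* [K >= N] suffices: the remainder is divisible by [q ^+ (d * K.+1)], and [d * K.+1 > N] because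
   [d > 0]. *)
exists N => K NK.
pose S := \sum_(n < K.+1) q ^+ (d * n) * fpsC (@chi R n).
have -> : u K = S * f.
  by rewrite mulr_suml; apply: eq_bigr => n _; rewrite mulrA.
apply/eqP; rewrite -subr_eq0 -fps_coefN -fps_coefD; apply/eqP.
have -> : S * f - f / P = (P * S - 1) * (f / P).
  transitivity (S * f * (P / P) - f / P); first by rewrite mulrV// mulr1.
  by ring.
rewrite /P chi_generating addrAC subrr add0r -mulrA.
by apply: fps_val_geXnM; nia.
Qed.

(** Induction on [n] removes one pair of factors, with exponent [m + n], at a time. *)
Lemma series_unimodal2_div_qpoch m n f : (0 < m)%N -> series_unimodal 2 f ->
  series_unimodal 2 (f / (qpoch (z * q ^+ m) n * qpoch (zV * q ^+ m) n)).
Proof.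
move=> m0 fu; have q0 c : (fpsC c * q ^+ m) 0%N = 0.
  by rewrite fpsC_mulE (@fps_val_geX _ q m) ?mulr0.
pose Q k := qpoch (z * q ^+ m) k * qpoch (zV * q ^+ m) k.
have Qu k : Q k \is a GRing.unit.
  by rewrite unitrM; apply/andP; split; apply: qpoch_unit; exact: q0.
rewrite -/(Q n); elim: n => [|n IHn].
  by rewrite /Q /qpoch !big_ord0 mulr1 divr1.
have QS : Q n.+1 = (1 - z * q ^+ (m + n)) * (1 - zV * q ^+ (m + n)) * Q n.
  by rewrite /Q /qpoch !big_ord_recr /= exprD; ring.
have := Qu n.+1; rewrite QS unitrM => /andP[Fu _].
rewrite invrM// mulrA; apply: series_unimodal2_div => //.
by rewrite addn_gt0 m0.
Qed.

(** The quotient is the q-adic limit of the quotients by finite products. *)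
Lemma series_unimodal2_div_qpoch_inf m f : (0 < m)%N -> series_unimodal 2 f ->
  series_unimodal 2 (f / (qpoch_inf (z * q ^+ m) * qpoch_inf (zV * q ^+ m))).
Proof.
move=> m0 fu; have q0 c : (fpsC c * q ^+ m) 0%N = 0.
  by rewrite fpsC_mulE (@fps_val_geX _ q m) ?mulr0.
apply: series_unimodal2_cvg (fun n => series_unimodal2_div_qpoch m n f m0 fu).
apply: fps_cvg_div.
- by move=> n; rewrite unitrM; apply/andP; split; apply: qpoch_unit; exact: q0.
- by rewrite unitrM; apply/andP; split; apply: qpoch_inf_unit; exact: q0.
- by apply: fps_cvgM; exact: qpoch_cvg.
Qed.

(** * The concave and convex composition series *)

Lemma serV_unimodal2 : series_unimodal 2 (serV R).
Proof.
apply: series_unimodal2_cvg (serV_cvg R) _ => N.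
apply: series_unimodal2_sum => n; apply: series_unimodal2_div_qpoch_inf => //.
by rewrite -[q ^+ n]mulr1; exact/series_unimodal2_Xn_mul/series_unimodal2_1.
Qed.

Lemma serX_unimodal2 : series_unimodal 2 (serX R).
Proof.
apply: series_unimodal2_cvg (serX_cvg R) _ => N.
(* The products start at [z * q], which is [z * q ^+ 1] by computation, hence [m = 1]. *)
apply: series_unimodal2_sum => n; apply: (series_unimodal2_div_qpoch 1) => //.
by rewrite -[_ ^+ _]mulr1; exact/series_unimodal2_Xn_mul/series_unimodal2_1.
Qed.

End SeriesUnimodal.

Theorem theorem4p2 (R : realType) :
  [/\ series_unimodal 2 (serV R),
      series_unimodal 2 (serX R) &
      forall m n : nat,
        Vcoef R (m + 2)%N%:Z n <= Vcoef R m%:Z n /\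
        Xcoef R (m + 2)%N%:Z n <= Xcoef R m%:Z n].
Proof.
split=> [||m n]; [exact: serV_unimodal2|exact: serX_unimodal2|].
have /laurent_unimodal2P[_ dV] := serV_unimodal2 R n.
have /laurent_unimodal2P[_ dX] := serX_unimodal2 R n.
by split; [exact: dV|exact: dX].
Qed.
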